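(* For any Abelian group $G$, the endomorphism ring $\mathrm{E}(G)$ is periodic if and only if $G$ is a finite group.
   Context: $\mathrm{E}(G)$ denotes the ring of all group endomorphisms of the Abelian group $G$ (under pointwise addition and composition). A ring $R$ is periodic if for every $x\in R$ there exist distinct positive integers $m\neq n$ with $x^m=x^n$. *)

(* Defs.v *)
From HB Require Import structures.
From mathcomp Require Import all_boot all_order all_algebra.
From mathcomp Require Import boolp classical_sets functions cardinality.

Set Implicit Arguments.
Unset Strict Implicit.
Unset Printing Implicit Defensive.

Import GRing.Theory.
Local Open Scope ring_scope.

Definition endo (G : zmodType) : Type := {additive G -> G}.

Section EndoRing.
Variable G : zmodType.
Implicit Types f g h : endo G.

Definition endo_fun f : G -> G := (f : {additive G -> G}).
Coercion endo_fun : endo >-> Funclass.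

Lemma endoP f g : (forall x, f x = g x) -> f = g.
Proof.
case: f g => [f [[fD]]] [g [[gD]]] /= fg.
have {fg}fg : f = g by apply/funext => x; exact: fg.
by case: _ / fg in gD *; rewrite (Prop_irrelevance fD gD).
Qed.

Definition endo_zero : endo G := (\0 : {additive G -> G}).
Definition endo_opp f : endo G :=
  (\- (f : {additive G -> G}) : {additive G -> G}).
Definition endo_add f g : endo G :=
  ((f : {additive G -> G}) \+ (g : {additive G -> G}) : {additive G -> G}).
Definition endo_one : endo G := (idfun : {additive G -> G}).
Definition endo_mul f g : endo G :=
  ((f : {additive G -> G}) \o (g : {additive G -> G}) : {additive G -> G}).

Lemma endo_addA : associative endo_add.
Proof. by move=> f g h; apply: endoP => x; exact: addrA. Qed.

Lemma endo_addC : commutative endo_add.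
Proof. by move=> f g; apply: endoP => x; exact: addrC. Qed.

Lemma endo_add0 : left_id endo_zero endo_add.
Proof. by move=> f; apply: endoP => x; exact: add0r. Qed.

Lemma endo_addN : left_inverse endo_zero endo_opp endo_add.
Proof. by move=> f; apply: endoP => x; exact: addNr. Qed.

Lemma endo_mulA : associative endo_mul.
Proof. by move=> f g h; apply: endoP. Qed.

Lemma endo_mul1l : left_id endo_one endo_mul.
Proof. by move=> f; apply: endoP. Qed.

Lemma endo_mul1r : right_id endo_one endo_mul.
Proof. by move=> f; apply: endoP. Qed.

Lemma endo_mulDl : left_distributive endo_mul endo_add.
Proof. by move=> f g h; apply: endoP. Qed.

Lemma endo_mulDr : right_distributive endo_mul endo_add.
Proof.
move=> f g h; apply: endoP => x.
exact: (raddfD (f : {additive G -> G})).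
Qed.

HB.instance Definition _ := gen_eqMixin (endo G).
HB.instance Definition _ := gen_choiceMixin (endo G).
HB.instance Definition _ :=
  GRing.isZmodule.Build (endo G) endo_addA endo_addC endo_add0 endo_addN.
(* Only a possibly-zero ring: the endomorphism ring of the trivial group
   satisfies 1 = 0. *)
HB.instance Definition _ :=
  GRing.Zmodule_isPzRing.Build (endo G)
    endo_mulA endo_mul1l endo_mul1r endo_mulDl endo_mulDr.

Lemma endo0E x : (0 : endo G) x = 0. Proof. by []. Qed.
Lemma endo1E x : (1 : endo G) x = x. Proof. by []. Qed.
Lemma endoDE f g x : (f + g) x = f x + g x. Proof. by []. Qed.
Lemma endoNE f x : (- f) x = - f x. Proof. by []. Qed.
Lemma endoME f g x : (f * g) x = f (g x). Proof. by []. Qed.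

End EndoRing.

Definition periodic_ring (R : pzRingType) : Prop :=
  forall x : R, exists m n : nat,
    [/\ (0 < m)%N, (0 < n)%N, m <> n & x ^+ m = x ^+ n].

(* Main.v *)
Require Import Defs.
From HB Require Import structures.
From mathcomp Require Import all_boot all_order all_algebra.
From mathcomp Require Import boolp classical_sets functions cardinality.

(** If E(G) is periodic then the powers of multiplication by 2 repeat, so N G = 0
for some N > 0. Suppose G is infinite. Some step of the divisibility chain from G
to N G = 0 leads from an infinite d G to a finite p d G with p prime; write
d = p^i m with m prime to p, and q = p^(i+1). Then the p-torsion of d G is
infinite while that of q G is finite, so one can choose y_0, y_1, ... of order q
with the p^i y_j independent modulo q G. These y_j span a free Z/q-module with
infinite basis, i.e. a copy of (Z/q)[X], which meets q G trivially; since Z/q is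
self-injective, it is a direct summand of G. Multiplication by X on that summand
(and 0 on a complement) is an endomorphism with pairwise distinct powers. *)

Set Implicit Arguments.
Unset Strict Implicit.
Unset Printing Implicit Defensive.

Import GRing.Theory.
Local Open Scope ring_scope.

(** * Additive maps and direct summands *)

Lemma additive_of (U V : zmodType) (f : U -> V) :
  {morph f : x y / x - y} -> exists g : {additive U -> V}, g =1 f.
Proof.
move=> fB.
pose F := GRing.isZmodMorphism.Build U V f fB.
pose g : {additive U -> V} := HB.pack f F.
by exists g.
Qed.

Lemma coprime_bezout (p k : nat) : (0 < k)%N -> coprime p k ->
  exists u v : nat, (k * u = p * v + 1)%N.
Proof.
move=> k0; rewrite coprime_sym => /eqP pk.
by have [u v e _] := egcdnP p k0; exists u, v; rewrite mulnC e pk mulnC.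
Qed.

(** With [g = 0] the last hypothesis makes [Phi] injective; in general it makes the image meet
    [p ^ i.+1] G trivially. The condition on [A] is the form in which the self-injectivity of Z/q
    enters: it lets a partial complement be enlarged. *)
Lemma additive_retraction (G A : zmodType) (Phi : {additive A -> G}) (p i : nat) :
  prime p ->
  (forall a : A, a *+ p ^ i = 0 -> exists b, a = b *+ p) ->
  (forall (a : A) g, Phi a = g *+ p ^ i.+1 -> a = 0) ->
  exists Psi : {additive G -> A}, cancel Phi Psi.
Proof.
move=> pP Adiv Phi_inj.
(* Write [q] for [p ^ i.+1]. A maximal set satisfying [P] is a complement of the
   image of [Phi]: being stable under [q G], it contains [q G] as soon as it is
   nonempty, while the empty set is allowed as the union of the empty chain. *)
pose P (C : set G) := [/\ forall c d, C c -> C d -> C (c - d),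
  forall c g, C c -> C (c + g *+ p ^ i.+1) & forall a, C (Phi a) -> a = 0].
have [C [[CB Cq CPhi] Cmax]] : exists C, P C /\ forall D, (C `<` D)%classic -> ~ P D.
  apply: Zorn_bigcup => F FP Ftot; split.
  - move=> c d [X FX Xc] [Y FY Yd].
    have [XY|YX] := Ftot _ _ FX FY.
      by exists Y => //; case: (FP _ FY) => XB _ _; apply: XB => //; apply: XY.
    by exists X => //; case: (FP _ FX) => XB _ _; apply: XB => //; apply: YX.
  - by move=> c g [X FX Xc]; exists X => //; case: (FP _ FX) => _ + _; apply.
  - by move=> a [X FX Xa]; case: (FP _ FX) => _ _; apply.
have C0 : C 0.
  apply: contrapT => nC0.
  have [[c Cc]|] := pselect (exists c, C c).
    by apply: nC0; rewrite -(subrr c); apply: CB.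
  move=> nC; apply: (Cmax [set g *+ p ^ i.+1 | g in [set: G]]%classic).
    split=> [c Cc|/(_ 0) H]; first by case: nC; exists c.
    by apply: nC0; apply: H; exists 0; rewrite ?mul0rn.
  split.
  - by move=> _ _ [c _ <-] [d _ <-]; exists (c - d) => //; rewrite mulrnBl.
  - by move=> _ g [c _ <-]; exists (c + g) => //; rewrite mulrnDl.
  - by move=> a [g _ /esym]; apply: Phi_inj.
have CN c : C c -> C (- c) by move=> Cc; rewrite -sub0r; apply: CB.
have CD c d : C c -> C d -> C (c + d).
  by move=> Cc Cd; rewrite -[d]opprK; apply: CB => //; apply: CN.
have CM c k : C c -> C (c *+ k).
  by move=> Cc; elim: k => [|k IH]; rewrite ?mulr0n // mulrS; apply: CD.
(* As [p^i a = 0], the element [a] is [b *+ p], so [p (z - Phi b)] lies in [C];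
   were the claim false, adjoining [z - Phi b] would contradict maximality. *)
have step z : (exists a, C (z *+ p - Phi a)) -> exists a, C (z - Phi a).
  move=> [a Ca].
  have /Adiv[b ab] : a *+ p ^ i = 0.
    apply: CPhi; rewrite raddfMn.
    have -> : Phi a *+ p ^ i = - ((z *+ p - Phi a) *+ p ^ i) + z *+ p ^ i.+1.
      by rewrite mulrnBl -mulrnA -expnS opprB subrK.
    by apply/Cq/CN/CM.
  pose z' := z - Phi b.
  have Cz' : C (z' *+ p) by rewrite mulrnBl -raddfMn -ab.
  apply: contrapT => nz.
  have nz' a' : ~ C (z' - Phi a').
    by move=> H; apply: nz; exists (b + a'); rewrite raddfD opprD addrA.
  apply: (Cmax [set c + z' *+ k | c in C & k in [set: nat]]%classic).
    split=> [c Cc|/(_ z') H]; first by exists c => //; exists 0%N; rewrite ?addr0.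
    apply: (nz' 0); rewrite raddf0 subr0; apply: H.
    by exists 0 => //; exists 1%N; rewrite ?add0r.
  split.
  - move=> _ _ [c Cc [k _ <-]] [d Cd [l _ <-]].
    (* Only natural multiples of [z'] are adjoined, so [- l] is written as [l * p.-1 - p * l], the
       multiple [z' *+ p] being in [C]. *)
    exists (c - d - z' *+ p *+ l); first by apply/CB/CM/Cz'/CB.
    exists (k + l * p.-1)%N => //.
    rewrite mulrnDr -mulrnA -[in (p * l)%N](prednK (prime_gt0 pP)) mulSn mulrnDr.
    rewrite [(_.-1 * _)%N]mulnC.
    rewrite -addrA [- _ + _]addrC opprD [X in _ + X]addrACA subrr addr0.
    by rewrite opprD addrACA.
  - move=> _ g [c Cc [k _ <-]]; exists (c + g *+ p ^ i.+1); first exact: Cq.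
    by exists k => //; rewrite addrAC.
  - move=> a' [c Cc [k _ e]]; apply: CPhi; rewrite -e.
    have [/dvdnP[l ->]|npk] := boolP (p %| k)%N.
      by apply: CD => //; rewrite mulnC mulrnA; apply: CM.
    (* Inverting [k] modulo [p] puts [z'] in the image of [Phi] modulo [C], against [nz']. *)
    exfalso; have k0 : (0 < k)%N by case: k npk {e}; rewrite ?dvdn0.
    have [u [v uv]] : exists u v : nat, (k * u = p * v + 1)%N.
      by apply: coprime_bezout => //; rewrite prime_coprime.
    apply: (nz' (a' *+ u)).
    have -> : z' - Phi (a' *+ u) = - (c *+ u + z' *+ p *+ v).
      rewrite raddfMn -e mulrnDl -!mulrnA uv mulrnDr mulr1n addrA.
      by rewrite [_ + z']addrC opprD addNKr.
    by apply/CN/CD; apply: CM.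
have decomp e z : C (z *+ p ^ e) -> exists a, C (z - Phi a).
  elim: e z => [|e IH] z Cz; first by exists 0; rewrite raddf0 subr0.
  by apply/step/IH; rewrite -mulrnA -expnS.
have /choice[f fP] : forall z, exists a, C (z - Phi a).
  by move=> z; apply: (decomp i.+1); rewrite -[_ *+ _]add0r; apply: Cq.
have uniqf z a : C (z - Phi a) -> f z = a.
  move=> Ca; apply/eqP; rewrite -subr_eq0; apply/eqP/CPhi; rewrite raddfB.
  have -> : Phi (f z) - Phi a = (z - Phi a) - (z - Phi (f z)).
    by rewrite opprB [RHS]addrC addrA subrK.
  exact: CB.
have [|g gf] := @additive_of _ _ f.
  move=> x y; apply: uniqf; rewrite raddfB.
  have -> : x - y - (Phi (f x) - Phi (f y)) = (x - Phi (f x)) - (y - Phi (f y)).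
    by rewrite !opprD addrACA.
  exact: CB.
by exists g => a; rewrite gf; apply: uniqf; rewrite subrr.
Qed.

(** * Infinite torsion and independent sequences *)

(** Otherwise [D] is covered by finitely many translates of a finite kernel, one for each value of
    [f] on [D]. *)
Lemma infinite_additive_kernel (G H : zmodType) (f : {additive G -> H}) (D : set G) :
  (forall x y, D x -> D y -> D (x - y)) ->
  ~ finite_set D -> finite_set (f @` D)%classic ->
  ~ finite_set [set x | D x /\ f x = 0]%classic.
Proof.
move=> DB Dinf fD Kfin; apply: Dinf.
have /choice[s sP] : forall z, exists x, (f @` D)%classic z -> D x /\ f x = z.
  move=> z; have [[x Dx <-]|nz] := pselect ((f @` D)%classic z); first by exists x.
  by exists 0.
apply: sub_finite_set (finite_image2 (fun z k => s z + k) fD Kfin) => x Dx.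
have [Ds fs] : D (s (f x)) /\ f (s (f x)) = f x by apply: sP; exists x.
exists (f x); first by exists x.
exists (x - s (f x)); last by rewrite addrC subrK.
by split; [apply: DB | rewrite raddfB fs subrr].
Qed.

(** Greedy choice: coefficients matter only modulo [p], so finitely many earlier terms and the
    finite set [Z] give finitely many combinations, which cannot exhaust [V]. *)
Lemma independent_sequence (G : zmodType) (p : nat) (V Z : set G) :
  (0 < p)%N -> (forall v, V v -> v *+ p = 0) ->
  ~ finite_set V -> finite_set Z ->
  exists x : nat -> G, (forall n, V (x n)) /\
    forall n (c : nat -> nat) z, Z z -> x n <> \sum_(j < n) x j *+ c j + z.
Proof.
move=> p0 Vp Vinf Zfin.
pose span (s : seq G) : set G := foldr (fun x (S : set G) =>
  [set v + x *+ a | v in S & a in `I_p]%classic) Z s.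
have span_fin s : finite_set (span s).
  by elim: s => //= x s IH; apply: finite_image2.
have /choice[next nextP] : forall s, exists v, V v /\ ~ span s v.
  move=> s; apply: contrapT => /forallNP H; apply: Vinf.
  apply: sub_finite_set (span_fin s) => v Vv.
  by apply: contrapT => nv; apply: (H v).
(* [s n] lists the first [n] terms, the latest first; the next one avoids [span (s n)]. *)
pose s := fix s n := if n is n'.+1 then next (s n') :: s n' else [::].
exists (fun n => next (s n)); split=> [n|n c z Zz]; first by case: (nextP (s n)).
move=> e; case: (nextP (s n)) => _; apply; rewrite {}e.
elim: n => [|n IH]; first by rewrite big_ord0 add0r.
rewrite big_ord_recr /= addrAC; eexists; first exact: IH.
exists (c n %% p)%N; first by rewrite /= ltn_pmod.
congr (_ + _); rewrite [in RHS](divn_eq (c n) p) mulrnDr mulnC mulrnA.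
by case: (nextP (s n)) => /Vp -> _; rewrite mul0rn add0r.
Qed.

(** * Polynomials over Z/q as a free module of infinite rank *)

Lemma Zp_mulrn_eq0 (q : nat) (a : 'Z_q) (n : nat) :
  (1 < q)%N -> a *+ n = 0 -> (q %| a * n)%N.
Proof.
move=> q1; rewrite -[a in a *+ _]natr_Zp -mulrnA => /(congr1 val) /=.
by rewrite val_Zp_nat // => /eqP.
Qed.

(** Coefficientwise: if [p ^ i.+1] divides [k * p ^ i], then [p] divides [k]. This supplies the
    condition on [A] in [additive_retraction]. *)
Lemma polyZp_divisible (p i : nat) (P : {poly 'Z_(p ^ i.+1)}) :
  prime p -> P *+ p ^ i = 0 -> exists Q, P = Q *+ p.
Proof.
move=> pP Pi0.
have q1 : (1 < p ^ i.+1)%N.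
  by rewrite -(exp1n i.+1) ltn_exp2r // prime_gt1.
exists (\poly_(j < size P) (nat_of_ord (P`_j)%R %/ p)%:R); apply/polyP => j.
rewrite coefMn coef_poly; case: ltnP => [_|Pj]; last by rewrite nth_default ?mul0rn.
rewrite -mulrnA divnK ?natr_Zp //.
have : P`_j *+ p ^ i = 0 by rewrite -coefMn Pi0 coef0.
move/(Zp_mulrn_eq0 q1); move: (nat_of_ord _) => k.
by rewrite expnS dvdn_pmul2r // expn_gt0 prime_gt0.
Qed.

Lemma poly_combination (G : zmodType) (q : nat) (y : nat -> G) :
  (1 < q)%N -> (forall j, y j *+ q = 0) ->
  exists Phi : {additive {poly 'Z_q} -> G}, forall P : {poly 'Z_q},
    Phi P = \sum_(j < size P) y j *+ nat_of_ord (P`_j)%R.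
Proof.
move=> q1 yq.
pose phi (P : {poly 'Z_q}) := \sum_(j < size P) y j *+ nat_of_ord (P`_j)%R.
(* Padding the sum gives [P], [Q] and [P + Q] a common range, even if the degree drops. *)
have phiE n (P : {poly 'Z_q}) : (size P <= n)%N ->
    phi P = \sum_(j < n) y j *+ nat_of_ord (P`_j)%R.
  move=> Pn; rewrite /phi (big_ord_widen n (fun j => y j *+ nat_of_ord (P`_j)%R) Pn).
  rewrite big_mkcond; apply: eq_bigr => j _.
  by case: ltnP => // Pj; rewrite nth_default.
have mod_q j a : y j *+ (a %% q) = y j *+ a.
  by rewrite [in RHS](divn_eq a q) mulrnDr mulnC mulrnA yq mul0rn add0r.
have phiD P Q : phi (P + Q) = phi P + phi Q.
  pose n := maxn (size P) (size Q).
  rewrite (phiE n P) ?leq_maxl // (phiE n Q) ?leq_maxr // (phiE n) ?size_polyD //.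
  rewrite -big_split; apply: eq_bigr => j _ /=.
  by rewrite coefD -mulrnDr -[RHS]mod_q; congr (_ *+ (_ %% _)); exact: Zp_cast.
have [|Phi PhiE] := @additive_of _ _ phi; last by exists Phi => P; rewrite PhiE.
by move=> P Q; apply/eqP; rewrite eq_sym subr_eq -phiD subrK.
Qed.

Lemma poly_summand (G : zmodType) (p m i : nat) :
  prime p -> coprime p m ->
  ~ finite_set (range (fun g : G => g *+ (p ^ i * m))) ->
  finite_set (range (fun g : G => g *+ (p ^ i.+1 * m))) ->
  exists (Phi : {additive {poly 'Z_(p ^ i.+1)} -> G})
         (Psi : {additive G -> {poly 'Z_(p ^ i.+1)}}), cancel Phi Psi.
Proof.
move=> pP pm Dinf pDfin; have p0 := prime_gt0 pP.
pose q := (p ^ i.+1)%N.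
have q1 : (1 < q)%N by rewrite -(exp1n i.+1) ltn_exp2r // prime_gt1.
pose D : set G := range (fun g : G => g *+ (p ^ i * m)).
have [|mulp mulpE] := @additive_of G G (fun x => x *+ p).
  by move=> x y; rewrite mulrnBl.
have Vinf := @infinite_additive_kernel G G mulp D.
pose V := [set x | D x /\ mulp x = 0]%classic.
(* Multiplication by [p] sends [D] into the finite set of multiples of [p ^ i.+1 * m]. *)
have {}Vinf : ~ finite_set V.
  apply: Vinf => //.
    by move=> _ _ [x _ <-] [y _ <-]; exists (x - y); rewrite ?mulrnBl.
  apply: sub_finite_set pDfin => _ [_ [g _ <-] <-]; exists g => //.
  by rewrite mulpE -mulrnA expnSr mulnAC.
pose Z := [set z : G | (exists g, z = g *+ q) /\ z *+ p = 0]%classic.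
(* As [m] is invertible modulo [p], each element of [Z] is also a multiple of [p ^ i.+1 * m]. *)
have Zfin : finite_set Z.
  apply: sub_finite_set pDfin => z [[g zg] pz].
  have m0 : (0 < m)%N.
    by case: m pm {Dinf D Vinf V} => //; rewrite /coprime gcdn0; case: (p) pP => [|[]].
  have [u [v uv]] := coprime_bezout m0 pm.
  exists (g *+ u) => //.
  have -> : z = z *+ (m * u) by rewrite uv mulrnDr mulrnA pz mul0rn add0r.
  by rewrite zg -!mulrnA; congr (_ *+ _); rewrite mulnCA [(u * m)%N]mulnC.
have Vp v : V v -> v *+ p = 0 by case=> _; rewrite mulpE.
have [x [xV xindep]] := independent_sequence p0 Vp Vinf Zfin.
have /choice[y yx] : forall n, exists g, g *+ p ^ i = x n.
  by move=> n; have [[g _ <-] _] := xV n; exists (g *+ m); rewrite -mulrnA mulnC.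
have yq n : y n *+ q = 0 by rewrite /q expnSr mulrnA yx Vp.
have [Phi PhiE] := poly_combination q1 yq.
(* When [p] kills [P], its coefficients are [p ^ i * b j], which turns the [y j] into the [x j]. The
   leading [b n] is invertible modulo [p]; solving for [x n] contradicts independence modulo [Z]. *)
have Phi_inj1 (P : {poly 'Z_q}) g : P *+ p = 0 -> Phi P = g *+ q -> P = 0.
  move=> pP0 Pg; apply/eqP; apply: contraT => Pn0.
  pose b j := (nat_of_ord (P`_j)%R %/ p ^ i)%N.
  have Pb j : nat_of_ord (P`_j)%R = (p ^ i * b j)%N.
    rewrite mulnC divnK //.
    have : P`_j *+ p = 0 by rewrite -coefMn pP0 coef0.
    move/(Zp_mulrn_eq0 q1); move: (nat_of_ord _) => k.
    by rewrite /q expnSr dvdn_pmul2r.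
  have [n sP] : exists n, size P = n.+1.
    by exists (size P).-1; rewrite prednK // lt0n size_poly_eq0.
  have bn0 : (0 < b n)%N.
    rewrite lt0n; apply: contraNneq Pn0 => bn.
    rewrite -lead_coef_eq0 lead_coefE sP /=; apply/eqP/val_inj.
    by rewrite /= Pb bn muln0.
  have bnp : (b n < p)%N.
    rewrite -(@ltn_pmul2l (p ^ i)) ?expn_gt0 ?p0 // -Pb -expnSr.
    by apply: leq_trans (ltn_ord _) _; rewrite Zp_cast.
  have [u [v uv]] : exists u v : nat, (b n * u = p * v + 1)%N.
    apply: coprime_bezout => //; rewrite prime_coprime //.
    by apply/negP => /(dvdn_leq bn0); rewrite leqNgt bnp.
  have {}Pg : \sum_(j < n) x j *+ b j + x n *+ b n = g *+ q.
    rewrite -Pg PhiE sP big_ord_recr /= Pb mulrnA yx; congr (_ + _).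
    by apply: eq_bigr => j _; rewrite Pb mulrnA yx.
  (* The factor [p.-1] stands for [-1], as [p] kills every [x j]. *)
  have xz : x n = \sum_(j < n) x j *+ (b j * u * p.-1) + g *+ u *+ q.
    rewrite -mulrnA mulnC mulrnA -Pg mulrnDl -mulrnA uv mulrnDr mulrnA Vp //.
    rewrite mul0rn add0r addrA -sumrMnl -big_split /= big1 ?add0r // => j _.
    rewrite -mulrnA -mulrnDr -{2}[(b j * u)%N]muln1 -mulnDr addn1 prednK //.
    by rewrite mulnC mulrnA Vp // mul0rn.
  suff Zg : Z (g *+ u *+ q).
    by case: (xindep n (fun j => (b j * u * p.-1)%N) _ Zg).
  split; first by exists (g *+ u).
  have -> : g *+ u *+ q = x n - \sum_(j < n) x j *+ (b j * u * p.-1).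
    by rewrite [X in X - _]xz addrC addKr.
  rewrite mulrnBl Vp // -sumrMnl big1 ?subrr // => j _.
  by rewrite -mulrnA mulnC mulrnA Vp // mul0rn.
(* The induction hypothesis applied to [P *+ p] reduces this to the case just treated. *)
have Phi_inj_exp e (P : {poly 'Z_q}) g : P *+ p ^ e = 0 -> Phi P = g *+ q -> P = 0.
  elim: e P g => [//|e IH] P g Pe Pg; apply: Phi_inj1 (Pg).
  apply: (IH _ (g *+ p)); first by rewrite -mulrnA -expnS.
  by rewrite raddfMn Pg -!mulrnA mulnC.
have Phi_inj (P : {poly 'Z_q}) g : Phi P = g *+ q -> P = 0.
  apply: (Phi_inj_exp i.+1); apply/polyP => j.
  by rewrite coefMn coef0 -mulr_natr pchar_Zp // mulr0.
have [|Psi PhiK] := additive_retraction pP _ Phi_inj; last by exists Phi, Psi.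
by move=> P; apply: polyZp_divisible.
Qed.

(** * Powers of endomorphisms and periodicity *)

Lemma endo_expS (G : zmodType) (f : endo G) n x : (f ^+ n.+1) x = f ((f ^+ n) x).
Proof. by rewrite exprS. Qed.

(** The [n]-th power of the transported multiplication by ['X] sends [Phi 1] to [Phi 'X^n], and
    [Psi] recovers ['X^n], whose size determines [n]. *)
Lemma poly_summand_not_periodic (G : zmodType) (R : nzRingType)
    (Phi : {additive {poly R} -> G}) (Psi : {additive G -> {poly R}}) :
  cancel Phi Psi -> ~ periodic_ring (endo G).
Proof.
move=> PhiK per.
have [|f fE] := @additive_of G G (fun x => Phi ('X * Psi x)).
  by move=> x y; rewrite raddfB mulrBr raddfB.
have fX n : ((f : endo G) ^+ n) (Phi 1) = Phi 'X^n.
  elim: n => [|n IH]; first by rewrite expr0.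
  by rewrite endo_expS IH /endo_fun fE PhiK -exprS.
have [m [n [_ _ mn fmn]]] := per (f : endo G).
apply: mn; have /(congr1 Psi) : Phi 'X^m = Phi 'X^n by rewrite -!fX fmn.
by rewrite !PhiK => /(congr1 (fun P : {poly R} => size P)); rewrite !size_polyXn => -[].
Qed.

Lemma periodic_endo_bounded (G : zmodType) :
  periodic_ring (endo G) -> exists2 N, (0 < N)%N & forall g : G, g *+ N = 0.
Proof.
move=> per.
have [|dbl dblE] := @additive_of G G (fun x => x *+ 2).
  by move=> x y; rewrite mulrnBl.
have dblX n g : ((dbl : endo G) ^+ n) g = g *+ 2 ^ n.
  elim: n => [|n IH]; first by rewrite expr0.
  by rewrite endo_expS IH /endo_fun dblE -mulrnA -expnSr.
have [m [n [_ _ mn fmn]]] := per (dbl : endo G).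
wlog lt_mn : m n mn fmn / (m < n)%N.
  move=> H; case: (ltngtP m n) => [lt|lt|//]; first exact: (H m n).
  by apply: (H n m) => // nm; apply: mn.
(* Two equal powers of doubling act as [2 ^ m] and [2 ^ n], so their difference kills the group. *)
exists (2 ^ n - 2 ^ m)%N; first by rewrite subn_gt0 ltn_exp2l.
move=> g; rewrite mulrnBr; last by rewrite leq_exp2l // ltnW.
by rewrite -!dblX fmn subrr.
Qed.

Lemma infinite_bounded_poly_summand (G : zmodType) (N : nat) :
  (0 < N)%N -> (forall g : G, g *+ N = 0) -> ~ finite_set [set: G]%classic ->
  exists (q : nat) (Phi : {additive {poly 'Z_q} -> G})
         (Psi : {additive G -> {poly 'Z_q}}), cancel Phi Psi.
Proof.
move=> N0 NG Ginf.
pose fin n := `[< finite_set (range (fun g : G => g *+ n)) >].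
have exN : exists n, (0 < n)%N && fin n.
  exists N; rewrite N0; apply/asboolP.
  by apply: sub_finite_set (finite_set1 0) => _ [g _ <-]; apply: NG.
(* Take [n] least positive with n G finite; removing a prime factor [p] leaves a [d] with d G
   infinite. *)
case: (ex_minnP exN) => n /andP[n0 /asboolP nfin] nmin.
have n1 : (1 < n)%N.
  rewrite ltn_neqAle n0 andbT; apply/eqP => n1; apply: Ginf.
  by apply: sub_finite_set nfin => g _; exists g; rewrite // -n1.
pose p := pdiv n; pose d := (n %/ p)%N.
have pP : prime p by apply: pdiv_prime.
have nE : n = (d * p)%N by rewrite divnK // pdiv_dvd.
have d0 : (0 < d)%N by move: n0; rewrite nE muln_gt0 => /andP[].
have dinf : ~ finite_set (range (fun g : G => g *+ d)).
  move=> dfin; have : (n <= d)%N by apply: nmin; rewrite d0; apply/asboolP.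
  by rewrite nE leqNgt ltn_Pmulr ?prime_gt1.
have [m pm dE] := pfactor_coprime pP d0.
exists (p ^ (logn p d).+1)%N; apply: (poly_summand (m := m)) => //.
  by rewrite mulnC -dE.
by rewrite expnS -mulnA [(_ * m)%N]mulnC -dE mulnC -nE.
Qed.

(** Pigeonhole: a power of [f] is determined by the self-map it induces on the positions of a list
    of the elements, and there are finitely many such maps. *)
Lemma finite_endo_periodic (G : zmodType) :
  finite_set [set: G]%classic -> periodic_ring (endo G).
Proof.
case/finite_seqP => s sG f.
have sP x : x \in s by have : [set: G]%classic x by []; rewrite sG.
pose T := {ffun 'I_(size s) -> 'I_(size s)}.
have idx_lt x : (index x s < size s)%N by rewrite index_mem.
(* The shift to [n.+1] keeps the exponents positive. *)
pose code n : T := [ffun j : 'I__ => Ordinal (idx_lt ((f ^+ n.+1) s`_j))].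
have code_inj m n : code m = code n -> f ^+ m.+1 = f ^+ n.+1.
  move=> e; apply: endoP => x.
  have := congr1 (fun c : T => val (c (Ordinal (idx_lt x)))) e.
  rewrite /code !ffunE /= nth_index // => /(congr1 (nth 0 s)).
  by rewrite !nth_index.
have /injectivePn[m [n mn /code_inj e]] : ~~ injectiveb (fun j : 'I_#|T|.+1 => code j).
  by apply/injectiveP => /leq_card; rewrite card_ord ltnn.
exists m.+1, n.+1; split=> // -[mn']; move/eqP: mn; apply; exact: val_inj.
Qed.

Theorem theorem3p5 (G : zmodType) :
  periodic_ring (endo G) <-> finite_set [set: G]%classic.
Proof.
split; last exact: finite_endo_periodic.
move=> per; apply: contrapT => Ginf.
have [N N0 NG] := periodic_endo_bounded per.
have [q [Phi [Psi PhiK]]] := infinite_bounded_poly_summand N0 NG Ginf.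
exact: poly_summand_not_periodic PhiK per.
Qed.
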